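(* Let $S^n$ be a piecewise flat approximation of a smooth manifold $M^n \subset N^{n+1}$, and let $\gamma$ be a path that is intrinsically straight within $S^n$. Then the geodesic-tangent curvature integral $\mathbb{K}_\gamma$ of $\gamma$ satisfies $$\mathbb{K}_\gamma = \sum_h \cos\theta_h \, \phi_h + O(\phi_h^3),$$ where the sum is over all hinges $h$ of $S^n$ that intersect $\gamma$, $\phi_h$ is the hinge angle at $h$, and $\theta_h$ is the angle that $\gamma$ makes with the normal vector to the hinge $h$ within $S^n$.
   Context: Piecewise flat manifold: an orientable $n$-dimensional simplicial manifold $S^n$ formed by joining flat Euclidean $n$-simplices along their $(n-1)$-dimensional faces; its intrinsic geometry is determined by the simplicial graph and the edge-lengths. The $(n-1)$-simplices are called hinges. Hinge angle: for $S^n \subset \mathbb{E}^{n+1}$ (Euclidean space), the hinge angle $\phi_h$ at a hinge $h$ is the angle between the unit normals of the two $n$-simplices meeting at $h$; equivalently, the angle between the vectors tangent to the two neighbouring $n$-simplices and orthogonal to $h$. It is taken positive if the two $n$-simplices are concave and negative if convex, relative to a given orientation. Piecewise flat approximation: if $N^{n+1}$ is Euclidean, $S^n$ is typically the piecewise flat manifold in $\mathbb{E}^{n+1}$ whose vertices are a set of points on $M^n$. If $N^{n+1}$ is non-Euclidean, a simplicial graph is constructed on $M^n$ with geodesic segments as edges, and $S^n$ is the piecewise flat manifold with the same graph and with edge-lengths equal to the lengths of the corresponding geodesic segments. $S^n$ is then extended to an $(n+1)$-dimensional piecewise flat approximation of $N^{n+1}$ in the region around $M^n$. The space around a hinge is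 then locally Euclidean on each side of $S^n$ (a series of flat connected $(n+1)$-simplices); a hinge angle is determined in the Euclidean way on each side of $S^n$, and $\phi_h$ is the average of the two. Geodesic-tangent curvature integral: $\mathbb{K}_\gamma$ is the total angular change in the unit tangent vector to the geodesic segment $\gamma$ along its length (counted positive if the change is in the direction of the positive normal, negative otherwise). When $N^{n+1}$ is non-Euclidean, the angular change at a hinge is, as for hinge angles, determined in the flat space on each side of $S^n$ and the two values are averaged. The term $O(\phi_h^3)$ is understood as the hinge angles tend to zero.
   Formalization: For non-Euclidean N, O(φ_h³) in the averaged angle fails if the side angles φ± nearly cancel; the remainder is Σ|φ_h|max(|φ₊|,|φ₋|)² with both side angles small. S is finite; γ crosses hinges only at interior points and ends inside n-simplices. *)

(* Defs.v *)
From HB Require Import structures.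
From mathcomp Require Import all_boot all_order all_algebra.
From mathcomp Require Import all_classical all_reals all_analysis.

Set Implicit Arguments.
Unset Strict Implicit.
Unset Printing Implicit Defensive.

Import Order.TTheory GRing.Theory Num.Theory.
Import numFieldNormedType.Exports.
Local Open Scope classical_set_scope.
Local Open Scope ring_scope.

(* The library's norm on 'rV[R]_m is the sup norm, hence [enorm]. *)
Section Euclidean.
Context {R : realType} {m : nat}.
Implicit Types u v : 'rV[R]_m.

Definition dot u v : R := (u *m v^T) 0 0.
Definition enorm u : R := Num.sqrt (dot u u).
Definition unitv u : 'rV[R]_m := (enorm u)^-1 *: u.
Definition angle u v : R := acos (dot u v / (enorm u * enorm v)).

(* The angle between u and v, counted positive if d is on the side of nu. *)
Definition signed_angle (nu d u v : 'rV[R]_m) : R :=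
  if 0 <= dot d nu then angle u v else - angle u v.

End Euclidean.

(* Smooth submanifolds of Euclidean space with the induced metric.  By Nash's
   theorem these are, up to isometry, all Riemannian manifolds. *)
Section Smooth.
Context {R : realType}.

Fixpoint Ck (k : nat) (U W : normedModType R) (D : set U) (f : U -> W) : Prop :=
  (forall x, D x -> {for x, continuous f}) /\
  if k is k'.+1 then
    (forall x, D x -> differentiable f x) /\
    (forall v : U, Ck k' D (fun x => 'D_v f x))
  else True.

Definition smooth (U W : normedModType R) (D : set U) (f : U -> W) : Prop :=
  forall k, Ck k D f.

(* X is locally the zero set of a smooth submersion. *)
Definition smooth_submanifold (d m : nat) (X : set 'rV[R]_m) : Prop :=
  (d <= m)%N /\
  forall x, X x -> exists (U : set 'rV[R]_m) (f : 'rV[R]_m -> 'rV[R]_(m - d)),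
    [/\ open U, U x, smooth U f,
        (forall y, U y -> forall z, exists v, 'D_v f y = z) &
        (forall y, U y -> (X y <-> f y = 0))].

Definition tangent (m : nat) (X : set 'rV[R]_m) (x v : 'rV[R]_m) : Prop :=
  exists c : R -> 'rV[R]_m,
    [/\ \forall t \near (0 : R), X (c t), c 0 = x & is_derive (0 : R) 1 c v].

(* X contains a unit-speed geodesic segment of length L from x to y: its
   acceleration has no component tangent to X. *)
Definition geodesic_segment (m : nat) (X : set 'rV[R]_m)
    (x y : 'rV[R]_m) (L : R) : Prop :=
  0 < L /\ exists (c : R -> 'rV[R]_m) (e : R),
    [/\ 0 < e, smooth [set t | - e < t < L + e] c, c 0 = x, c L = y &
      forall t, - e < t < L + e ->
        [/\ X (c t), enorm (derive1 c t) = 1 &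
            forall v, tangent X (c t) v -> dot (derive1n 2 c t) v = 0]].

End Smooth.

(* A simplicial complex with vertex set 'I_V is given by the set of its maximal
   simplices.  Its points are rows of barycentric coordinates.  The rows of a
   matrix [p : 'M_(V, m)] are positions of the vertices in E^m, and [x *m p] is
   then the position of the point [x]. *)
Section Complexes.
Context {R : realType} {V : nat}.
Implicit Types (s t h : {set 'I_V}) (S T : {set {set 'I_V}})
  (l : 'I_V -> 'I_V -> R).

Definition simplex s : set 'rV[R]_V :=
  [set x | [/\ forall v, 0 <= x 0 v, forall v, v \notin s -> x 0 v = 0
             & \sum_v x 0 v = 1]].

Definition open_simplex s : set 'rV[R]_V :=
  [set x | simplex s x /\ forall v, v \in s -> 0 < x 0 v].

Definition realization S : set 'rV[R]_V :=
  [set x | exists2 s, s \in S & simplex s x].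

(* Purely d-dimensional, with a realization that is a topological manifold
   (possibly with boundary): each point has a neighbourhood homeomorphic to an
   open subset of the half-space {y | y_0 >= 0}. *)
Definition simplicial_manifold (d : nat) S : Prop :=
  (forall s, s \in S -> #|s| = d.+1) /\
  forall x, realization S x ->
    exists (U : set 'rV[R]_V) (W : set 'rV[R]_d)
           (f : 'rV[R]_V -> 'rV[R]_d) (g : 'rV[R]_d -> 'rV[R]_V),
      let A := realization S `&` U in
      let B := [set y : 'rV[R]_d | forall i, nat_of_ord i = 0%N -> 0 <= y 0 i] `&` W in
      [/\ open U, U x & open W] /\
      [/\ {within A, continuous f}, {within B, continuous g},
          forall z, A z -> B (f z) /\ g (f z) = z &
          forall y, B y -> A (g y) /\ f (g y) = y].

(* Facets s and t which share a hinge induce opposite orientations on it; the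
   Boolean [o s] compares the orientation chosen on s with the one given by the
   order of 'I_V. *)
Definition orientable S : Prop :=
  exists o : {set 'I_V} -> bool,
    forall s t a b, s \in S -> t \in S -> s != t -> a \in s -> b \in t ->
      s :\ a = t :\ b ->
      o s (+) odd #|[set v in s | (v < a)%N]|
        != o t (+) odd #|[set v in t | (v < b)%N]|.

Definition pos (m : nat) (p : 'M[R]_(V, m)) (v : 'I_V) : 'rV[R]_m := row v p.

(* [p] places s in E^m as a nondegenerate simplex with the edge-lengths l. *)
Definition flat_chart l (m : nat) s (p : 'M[R]_(V, m)) : Prop :=
  (forall v w, v \in s -> w \in s -> enorm (pos p v - pos p w) = l v w) /\
  (forall c : 'rV[R]_V, (forall v, v \notin s -> c 0 v = 0) ->
     \sum_v c 0 v = 0 -> c *m p = 0 -> c = 0).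

Definition piecewise_flat (d : nat) S l : Prop :=
  [/\ simplicial_manifold d S, orientable S &
      forall s, s \in S -> exists p : 'M[R]_(V, d), flat_chart l s p].

(* [p] unfolds the simplices [a |: h] and [b |: h], which share the face h, into
   E^m, on opposite sides of h; [nu] is a unit normal to h, directed from the
   first to the second.  When #|h| = m this determines nu. *)
Definition unfolding l (m : nat) h (a b : 'I_V) (p : 'M[R]_(V, m))
    (nu : 'rV[R]_m) : Prop :=
  [/\ flat_chart l (a |: h) p, flat_chart l (b |: h) p, enorm nu = 1,
      forall v w, v \in h -> w \in h -> dot nu (pos p v - pos p w) = 0 &
      forall w, w \in h ->
        dot nu (pos p a - pos p w) < 0 < dot nu (pos p b - pos p w)].

Definition unit_normal (m : nat) s (p : 'M[R]_(V, m)) (nu : 'rV[R]_m) : Prop :=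
  enorm nu = 1 /\
  forall v w, v \in s -> w \in s -> dot nu (pos p v - pos p w) = 0.

End Complexes.

(* A polygonal path crossing [ncross] hinges.  It runs through
   facet 0, ..., facet ncross, inside facet i from node i to node i.+1; the i-th
   hinge crossed is obtained by deleting the vertex [leave i] from facet i, and
   facet i.+1 is spanned by this hinge and the vertex [enter i].  Values at
   indices beyond the range are irrelevant. *)
Record polygonal_path (R : realType) (V : nat) := PolygonalPath {
  ncross : nat;
  facet : nat -> {set 'I_V};
  leave : nat -> 'I_V;
  enter : nat -> 'I_V;
  node : nat -> 'rV[R]_V }.

Section Paths.
Context {R : realType} {V : nat}.
Implicit Types (S : {set {set 'I_V}}) (l : 'I_V -> 'I_V -> R)
  (g : polygonal_path R V).

Definition hinge g i : {set 'I_V} := facet g i :\ leave g i.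

Definition segment g i : 'rV[R]_V := node g i.+1 - node g i.

(* The endpoints of the path are interior to facets, and each crossing is
   interior to a hinge, so the hinges that meet the path are those crossed. *)
Definition is_path S g : Prop :=
  [/\ forall i, (i <= ncross g)%N -> facet g i \in S /\ node g i != node g i.+1,
      forall i, (i < ncross g)%N ->
        [/\ leave g i \in facet g i, enter g i \notin facet g i &
            facet g i.+1 = enter g i |: hinge g i],
      open_simplex (facet g 0) (node g 0),
      open_simplex (facet g (ncross g)) (node g (ncross g).+1) &
      forall i, (i < ncross g)%N -> open_simplex (hinge g i) (node g i.+1)].

Definition path_unfolding l (n : nat) g
    (u : nat -> 'M[R]_(V, n)) (nu : nat -> 'rV[R]_n) : Prop :=
  forall i, (i < ncross g)%N ->
    unfolding l (hinge g i) (leave g i) (enter g i) (u i) (nu i).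

(* At each hinge crossed, the path is a straight line after the two facets are
   unfolded into E^n. *)
Definition intrinsically_straight (n : nat) g (u : nat -> 'M[R]_(V, n)) : Prop :=
  forall i, (i < ncross g)%N ->
    unitv (segment g i *m u i) = unitv (segment g i.+1 *m u i).

(* Angle between the path and the normal to the i-th hinge within S. *)
Definition theta (n : nat) g (u : nat -> 'M[R]_(V, n))
    (nu : nat -> 'rV[R]_n) i : R :=
  angle (segment g i *m u i) (nu i).

End Paths.

(* Positions in E^m of the vertices of two facets which share a hinge, with the
   positive unit normals of the first and of the second facet. *)
Record hinge_chart (R : realType) (V m : nat) := HingeChart {
  place : 'M[R]_(V, m);
  normal1 : 'rV[R]_m;
  normal2 : 'rV[R]_m }.

Section Hinges.
Context {R : realType} {V m : nat}.
Implicit Types (g : polygonal_path R V) (C : nat -> hinge_chart R V m).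

(* Positive when the second facet lies on the positive side of the first, that
   is, when the two facets are concave. *)
Definition hinge_angle g C i : R :=
  signed_angle (normal1 (C i))
    (pos (place (C i)) (enter g i) - pos (place (C i)) (leave g i))
    (normal1 (C i)) (normal2 (C i)).

(* Positive when the unit tangent changes in the direction of the positive
   normal. *)
Definition tangent_angle g C i : R :=
  let t1 := unitv (segment g i *m place (C i)) in
  let t2 := unitv (segment g i.+1 *m place (C i)) in
  signed_angle (normal1 (C i)) (t2 - t1) t1 t2.

Definition mean_angle (f : bool -> nat -> R) i : R := (f true i + f false i) / 2.

End Hinges.

Section EuclideanAmbient.
Context {R : realType} {V n : nat}.
Implicit Types (S : {set {set 'I_V}}) (p : 'M[R]_(V, n.+1)).

Definition edge_length p (v w : 'I_V) : R := enorm (pos p v - pos p w).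

(* A hypersurface of E^(n+1) with vertices on the smooth hypersurface M. *)
Definition euclidean_approximation (M : set 'rV[R]_n.+1) S p : Prop :=
  [/\ smooth_submanifold n M,
      piecewise_flat n S (edge_length p),
      forall x y, realization S x -> realization S y -> x *m p = y *m p -> x = y
    & forall s v, s \in S -> v \in s -> M (pos p v)].

(* [nu] is the field of positive unit normals of an orientation of S.  For
   facets which share the hinge {w_0, ..., w_(n-1)}, the frames
   (normal, w_0 - a, ..., w_(n-1) - a) and (normal, w_0 - b, ..., w_(n-1) - b)
   have opposite signs because the facets induce opposite orientations on the
   hinge. *)
Definition positive_normals S p (nu : {set 'I_V} -> 'rV[R]_n.+1) : Prop :=
  (forall s, s \in S -> unit_normal s p (nu s)) /\
  (forall (h : {set 'I_V}) (a b : 'I_V) (w : 'I_n -> 'I_V),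
     a \notin h -> b \notin h -> a != b -> a |: h \in S -> b |: h \in S ->
     injective w -> (forall i, w i \in h) ->
     let frame c : 'M[R]_(1 + n) :=
       col_mx (nu (c |: h)) (\matrix_(i < n) (pos p (w i) - pos p c)) in
     \det (frame a) * \det (frame b) < 0).

Definition euclidean_chart (g : polygonal_path R V) p
    (nu : {set 'I_V} -> 'rV[R]_n.+1) (i : nat) : hinge_chart R V n.+1 :=
  HingeChart p (nu (facet g i)) (nu (facet g i.+1)).

End EuclideanAmbient.

Section GeneralAmbient.
Context {R : realType} {V n : nat}.
Implicit Types (S T : {set {set 'I_V}}) (l : 'I_V -> 'I_V -> R)
  (side : bool -> {set 'I_V} -> {set 'I_V}).

Definition is_edge S (v w : 'I_V) : Prop :=
  v != w /\ exists s, [/\ s \in S, v \in s & w \in s].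

(* S and its extension T approximate M and the region of N around M; q places
   the vertices in N.  The edge-lengths of both are the lengths of geodesic
   segments, which for the edges of S may be taken in M or in N. *)
Definition riemannian_approximation (m : nat) (M N : set 'rV[R]_m)
    (q : 'M[R]_(V, m)) S T l : Prop :=
  [/\ smooth_submanifold n M, smooth_submanifold n.+1 N & M `<=` N] /\
  [/\ piecewise_flat n S l, piecewise_flat n.+1 T l &
      forall s, s \in S -> exists2 t, t \in T & s \subset t] /\
  [/\ injective (pos q),
      (forall s v, s \in S -> v \in s -> M (pos q v)),
      (forall t v, t \in T -> v \in t -> N (pos q v)),
      (forall v w, is_edge S v w ->
         geodesic_segment M (pos q v) (pos q w) (l v w) \/
         geodesic_segment N (pos q v) (pos q w) (l v w)) &
      (forall v w, is_edge T v w -> ~ is_edge S v w ->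
         geodesic_segment N (pos q v) (pos q w) (l v w))].

(* [side true s] and [side false s] are the (n+1)-simplices of T on the positive
   and on the negative side of the facet s of S. *)
Definition two_sided S T side : Prop :=
  forall s, s \in S ->
    (forall e, side e s \in T /\ s \subset side e s) /\
    side true s <> side false s.

(* On the side e of S, the facets [a |: h] and [b |: h] are joined by the series
   of (n+1)-simplices [v j |: (v j.+1 |: h)], j < r, of T around h.  The chart C
   develops this series into E^(n+1), with successive simplices on opposite
   sides of their common face. *)
Definition side_development l T side (e : bool) (h : {set 'I_V}) (a b : 'I_V)
    (C : hinge_chart R V n.+1) : Prop :=
  let p := place C in
  exists (r : nat) (v : nat -> 'I_V),
    let F j := v j |: (v j.+1 |: h) in
    [/\ (0 < r)%N, v 0%N = a, v r = b &
        forall i j, (i <= r)%N -> (j <= r)%N -> v i = v j -> i = j] /\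
    [/\ forall j, (j < r)%N -> F j \in T /\ flat_chart l (F j) p,
        forall j, (j.+1 < r)%N ->
          exists nu, unfolding l (v j.+1 |: h) (v j) (v j.+2) p nu,
        side e (a |: h) = F 0%N & side e (b |: h) = F r.-1] /\
    [/\ unit_normal (a |: h) p (normal1 C), unit_normal (b |: h) p (normal2 C),
        0 < (-1) ^+ (~~ e) * dot (normal1 C) (pos p (v 1%N) - pos p a) &
        0 < (-1) ^+ (~~ e) * dot (normal2 C) (pos p (v r.-1) - pos p b)].

Definition path_developments l T side (g : polygonal_path R V)
    (C : bool -> nat -> hinge_chart R V n.+1) : Prop :=
  forall e i, (i < ncross g)%N ->
    side_development l T side e (hinge g i) (leave g i) (enter g i) (C e i).

End GeneralAmbient.

(* Main.v *)
Require Import Defs.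
From mathcomp Require Import all_boot all_order all_algebra.
From mathcomp Require Import all_classical all_reals all_analysis.
From mathcomp Require Import ring lra.
Import Order.TTheory GRing.Theory Num.Theory.
Import numFieldNormedType.Exports.
Local Open Scope classical_set_scope.
Local Open Scope ring_scope.

(** The unfolding of the two facets at a hinge provides a common conormal: the
    unit normal nu to the hinge within the facets, which becomes e1 in the first
    facet and e2 in the second when the facets are placed in E^(n+1).  A straight
    path has the same components along nu and along the hinge on both sides
    ([straight_decomposition]), so its unit tangents are k e1 + z and k e2 + z,
    where k = cos theta >= 0 and z is parallel to the hinge.

    The conormals and the facet normals N1, N2 lie in the plane orthogonal to the
    hinge.  If the normals are coherent, (N1, e1) is carried to (N2, e2) by a
    rotation, so e1 and e2 form the hinge angle phi ([frames_coherent]).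
    Coherence is where the two ambient geometries differ.  For a hypersurface of
    E^(n+1) it follows from the determinants that define an orientation
    ([orientation_frames]); in a development around the hinge it follows because
    the successive simplices all turn in the same sense
    ([coherent_development]).

    The distance between the tangents is k |e2 - e1|, so the path turns by exactly
    bend k phi = 2 asin (k sin (phi / 2)), with sign ([tangent_angle_bend]).  This
    function is odd in phi and differs from k phi by a function whose derivative
    is O(phi ^ 2).  The mean value theorem then bounds the error at one hinge by
    |phi| ^ 3, and the mean of the errors on the two sides by
    |phi| max(|phi_+|, |phi_-|) ^ 2, where phi is the mean hinge angle
    ([bend_bound], [bend_mean_bound]).  Both parts hold with constant 1 for hinge
    angles of modulus at most 1. *)

Set Implicit Arguments.
Unset Strict Implicit.
Unset Printing Implicit Defensive.

(** * The bend of a straight line as a function of the hinge angle *)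

Section Bend.
Context {R : realType}.
Implicit Types k x y r : R.

Lemma lipschitz_of_derive (f df : R -> R) (r M : R) :
  (forall x, `|x| <= r -> is_derive x 1 f (df x)) ->
  (forall x, `|x| <= r -> `|df x| <= M) ->
  forall x y, `|x| <= r -> `|y| <= r -> `|f x - f y| <= M * `|x - y|.
Proof.
move=> fdf dfM x y xr yr.
wlog xy : x y xr yr / y <= x.
  move=> ih; have [xy|/ltW yx] := leP y x; first exact: ih.
  by rewrite distrC (distrC x); exact: ih.
have inr z : z \in `[y, x] -> `|z| <= r.
  by move: xr yr; rewrite in_itv /= !ler_norml; lra.
have fdf' z : z \in `]y, x[ -> is_derive z 1 f (df z).
  by move=> zin; apply/fdf/inr; move: zin; rewrite !in_itv /=; lra.
have cf : {within `[y, x], continuous f}.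
  apply: derivable_within_continuous => z zin.
  by have [] := fdf z (inr z zin).
have [z zin ->] := MVT_segment xy fdf' cf.
by rewrite normrM ler_wpM2r// dfM// inr.
Qed.

Lemma abs_sin_le x : `|sin x| <= `|x|.
Proof.
have cos1 z : `|z| <= `|x| -> `|cos z| <= 1.
  by move=> _; rewrite ler_norml cos_geN1 cos_le1.
have := lipschitz_of_derive (fun z _ => is_derive_sin z) cos1 (lexx _).
by move=> /(_ 0); rewrite normr0 sin0 !subr0 mul1r; exact.
Qed.

Lemma sqr_le_norm x y : `|x| <= `|y| -> x ^+ 2 <= y ^+ 2.
Proof.
move=> xy; rewrite -(@real_normK _ x) ?num_real// -(@real_normK _ y) ?num_real//.
by rewrite lerXn2r ?nnegrE.
Qed.

Lemma cos_ge_sqr x : 1 - x ^+ 2 / 2 <= cos x.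
Proof.
have cosx : cos x = 1 - 2 * sin (x / 2) ^+ 2.
  have {1}-> : x = (x / 2) *+ 2 by rewrite -mulr_natr divfK.
  by rewrite cos_mulr2n cos2sin2 !mulr2n; ring.
have := sqr_le_norm (abs_sin_le (x / 2)); rewrite {}cosx.
rewrite expr_div_n; move: (sin _ ^+ 2) (x ^+ 2) => s t; lra.
Qed.

(** The angle psi between two unit vectors k e1 + z and k e2 + z, where z is
    orthogonal to the unit vectors e1 and e2 and these form the angle x: their
    distance is k |e2 - e1|, so that sin (psi / 2) = k sin (x / 2).  Both angles
    are signed. *)
Definition bend k x : R := 2 * asin (k * sin (x / 2)).

Lemma asinN y : -1 <= y <= 1 -> asin (- y) = - asin y.
Proof.
move=> y1; have [asy sy] := asin_def y1.
rewrite -{1}sy -sinN sinK// in_itv /=; lra.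
Qed.

Lemma asin0 : asin 0 = 0 :> R.
Proof. by have := @asinN 0; rewrite oppr0; lra. Qed.

(** Keeps the argument of asin away from the points -1 and 1, where asin is not
    differentiable. *)
Lemma mul_sin_half_bound k x : 0 <= k <= 1 -> `|x| <= 1 ->
  `|k * sin (x / 2)| <= 1 / 2.
Proof.
move=> /andP[k0 k1] x1.
rewrite normrM (ger0_norm k0).
have := abs_sin_le (x / 2); rewrite normrM [`|2^-1|]ger0_norm ?invr_ge0// => h.
have := ler_pM k0 (normr_ge0 (sin (x / 2))) k1 h; lra.
Qed.

Lemma bendN k x : 0 <= k <= 1 -> `|x| <= 1 -> bend k (- x) = - bend k x.
Proof.
move=> k01 x1; rewrite /bend mulNr sinN mulrN asinN ?mulrN//.
have := mul_sin_half_bound k01 x1; rewrite ler_norml; lra.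
Qed.

Lemma is_derive_bend k x : 0 <= k <= 1 -> `|x| <= 1 ->
  is_derive x 1 (bend k)
    (k * (cos (x / 2) / Num.sqrt (1 - (k * sin (x / 2)) ^+ 2))).
Proof.
move=> k01 x1.
have hlt : -1 < k * sin (x / 2) < 1.
  by have := mul_sin_half_bound k01 x1; rewrite ler_norml; lra.
have d1 : is_derive x 1 (fun x : R => x / 2) (2^-1 : R).
  by apply: is_derive_eq; rewrite !scaler0 add0r scaler1.
have d2 := @is_derive1_comp R sin (fun x => x / 2) x _ _ (is_derive_sin (x / 2)) d1.
have d3 : is_derive x 1 (fun x => k * sin (x / 2)) (k * (cos (x / 2) / 2)).
  exact: (is_deriveZ k d2).
have d4 := @is_derive1_comp R asin (fun x => k * sin (x / 2)) x _ _ (is_derive1_asin hlt) d3.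
have d5 : is_derive x 1 (bend k)
   (2 * ((Num.sqrt (1 - (k * sin (x / 2)) ^+ 2))^-1 * (k * (cos (x / 2) / 2)))).
  exact: (is_deriveZ 2 d4).
apply: is_derive_eq; field.
rewrite sqrtr_eq0 -ltNge.
have := mul_sin_half_bound k01 x1; rewrite ler_norml; nra.
Qed.

(** The derivative of bend k x - k x is k (cos (x / 2) / q - 1), where
    q = sqrt (1 - k ^ 2 sin ^ 2 (x / 2)) lies between cos (x / 2) and 1 because
    k <= 1.  It therefore has modulus at most 1 - cos (x / 2) <= x ^ 2 / 8, which
    is below the bound r ^ 2 used here. *)
Lemma bend_lipschitz k x y r : 0 <= k <= 1 -> r <= 1 -> `|x| <= r -> `|y| <= r ->
  `|(bend k x - k * x) - (bend k y - k * y)| <= r ^+ 2 * `|x - y|.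
Proof.
move=> k01 r1.
apply: (@lipschitz_of_derive (fun x => bend k x - k * x) (fun x =>
  k * (cos (x / 2) / Num.sqrt (1 - (k * sin (x / 2)) ^+ 2)) - k)) => {}x xr.
  have x1 : `|x| <= 1 by exact: le_trans r1.
  have d := is_derive_bend k01 x1.
  by apply: is_derive_eq; rewrite scaler1.
have x1 : `|x| <= 1 by exact: le_trans r1.
have kb := mul_sin_half_bound k01 x1.
move/andP: k01 => [k0 k1].
set c := cos _; set q := Num.sqrt _.
have cge : 1 - (x / 2) ^+ 2 / 2 <= c := cos_ge_sqr _.
have x2r : x ^+ 2 <= r ^+ 2.
  by apply: sqr_le_norm; rewrite (le_trans xr)// ler_norm.
have x21 : x ^+ 2 <= 1.
  by rewrite -[x ^+ 2]real_normK ?num_real// expr_le1.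
have c0 : 0 < c by nra.
have cs := cos2Dsin2 (x / 2); rewrite -/c in cs.
have k2s : (k * sin (x / 2)) ^+ 2 <= sin (x / 2) ^+ 2.
  by rewrite exprMn ler_piMl ?sqr_ge0// expr_le1.
have cq : c <= q.
  rewrite -[c]ger0_norm ?(ltW c0)// -sqrtr_sqr ler_sqrt; first lra.
  by move: kb; rewrite ler_norml; nra.
have q1 : q <= 1.
  by rewrite -[leRHS]sqrtr1 ler_sqrt// gerBl sqr_ge0.
have q0 : 0 < q := lt_le_trans c0 cq.
have cq1 : c / q <= 1 by rewrite ler_pdivrMr// mul1r.
have ccq : c <= c / q by rewrite ler_pdivlMr// ler_piMr// ltW.
rewrite ler_norml; nra.
Qed.

(** Since bend k is odd, the sum of the errors at x and y is the difference of
    the errors at x and -y.  The Lipschitz estimate then produces the factor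
    |x + y|, which an estimate of each error separately would lose. *)
Lemma bend_mean_bound k x y : 0 <= k <= 1 -> `|x| <= 1 -> `|y| <= 1 ->
  `|(bend k x + bend k y) / 2 - k * ((x + y) / 2)|
    <= `|(x + y) / 2| * Num.max `|x| `|y| ^+ 2.
Proof.
move=> k01 x1 y1.
have m1 : Num.max `|x| `|y| <= 1 by rewrite ge_max x1.
have := @bend_lipschitz k x (- y) _ k01 m1; rewrite normrN !le_max !lexx orbT.
move=> /(_ isT isT); rewrite bendN//.
rewrite (_ : _ - _ = 2 * ((bend k x + bend k y) / 2 - k * ((x + y) / 2))); last by field.
rewrite normrM [`|2|]ger0_norm// opprK.
rewrite (_ : `|x + y| = 2 * `|(x + y) / 2|); last first.
  by rewrite normrM [`|2^-1|]ger0_norm ?invr_ge0//; field.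
set m := Num.max _ _; nra.
Qed.

Lemma bend_bound k x : 0 <= k <= 1 -> `|x| <= 1 ->
  `|bend k x - k * x| <= `|x| ^+ 3.
Proof.
move=> k01 x1.
have := @bend_lipschitz k x 0 _ k01 x1; rewrite lexx normr0 normr_ge0.
move=> /(_ isT isT).
have -> : bend k 0 = 0 by rewrite /bend mul0r sin0 mulr0 asin0 mulr0.
by rewrite mulr0 !subr0 -exprSr.
Qed.

(** Ties [bend] to the angle of two unit vectors: the argument of acos is the
    scalar product of k e1 + z and k e2 + z when e1 and e2 form the angle x. *)
Lemma acos_bend k x : 0 <= k <= 1 -> 0 <= x <= 1 ->
  acos (1 - k ^+ 2 * (1 - cos x)) = bend k x.
Proof.
move=> k01 x01; have x1 : `|x| <= 1 by rewrite ler_norml; lra.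
have := mul_sin_half_bound k01 x1; rewrite /bend ler_norml => kb.
have [ab sab] : - (pi / 2) <= asin (k * sin (x / 2)) <= pi / 2
    /\ sin (asin (k * sin (x / 2))) = k * sin (x / 2).
  by apply: asin_def; lra.
have cx : 1 - k ^+ 2 * (1 - cos x) = cos (2 * asin (k * sin (x / 2))).
  rewrite [2 * _]mulr_natl cos_mulr2n cos2sin2 sab.
  have {1}-> : x = (x / 2) *+ 2 by rewrite -mulr_natr divfK.
  by rewrite cos_mulr2n cos2sin2 !mulr2n; ring.
rewrite cx cosK// in_itv /=.
have a0 : 0 <= asin (k * sin (x / 2)); last by lra.
have s0 : 0 <= k * sin (x / 2).
  case/andP: k01 => k0 _; rewrite mulr_ge0// sin_ge0_pi//.
  by have := pi_ge2 R; lra.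
rewrite leNgt; apply/negP => a0.
suff : sin (asin (k * sin (x / 2))) < 0 by rewrite sab; lra.
rewrite -oppr_gt0 -sinN sin_gt0_pi//; have := pi_ge2 R; lra.
Qed.

End Bend.

(** * The Euclidean scalar product *)

Section Dot.
Context {R : realType} {m : nat}.
Implicit Types x y z : 'rV[R]_m.

Lemma dot_sum x y : dot x y = \sum_i x 0 i * y 0 i.
Proof. by rewrite /dot mxE; apply: eq_bigr => i _; rewrite mxE. Qed.

Lemma dotC x y : dot x y = dot y x.
Proof. by rewrite !dot_sum; apply: eq_bigr => i _; rewrite mulrC. Qed.

Lemma dotDl x y z : dot (x + y) z = dot x z + dot y z.
Proof. by rewrite /dot mulmxDl mxE. Qed.

Lemma dotZl a x y : dot (a *: x) y = a * dot x y.
Proof. by rewrite /dot -scalemxAl mxE. Qed.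

Lemma dotNl x y : dot (- x) y = - dot x y.
Proof. by rewrite /dot mulNmx mxE. Qed.

Lemma dot0l x : dot 0 x = 0.
Proof. by rewrite /dot mul0mx mxE. Qed.

Lemma dotDr x y z : dot x (y + z) = dot x y + dot x z.
Proof. by rewrite dotC dotDl !(dotC x). Qed.

Lemma dotZr a x y : dot x (a *: y) = a * dot x y.
Proof. by rewrite dotC dotZl (dotC x). Qed.

Lemma dotNr x y : dot x (- y) = - dot x y.
Proof. by rewrite dotC dotNl (dotC x). Qed.

Lemma dot0r x : dot x 0 = 0.
Proof. by rewrite dotC dot0l. Qed.

Lemma dot_suml (I : finType) (F : I -> 'rV[R]_m) y :
  dot (\sum_i F i) y = \sum_i dot (F i) y.
Proof. by rewrite /dot mulmx_suml summxE. Qed.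

Lemma dot_sumr (I : finType) (F : I -> 'rV[R]_m) y :
  dot y (\sum_i F i) = \sum_i dot y (F i).
Proof. by rewrite dotC dot_suml; apply: eq_bigr => i _; rewrite dotC. Qed.

Definition dotE := (dotDl, dotDr, dotNl, dotNr, dotZl, dotZr, dot0l, dot0r).

Lemma dot_ge0 x : 0 <= dot x x.
Proof. by rewrite dot_sum sumr_ge0// => i _; rewrite -expr2 sqr_ge0. Qed.

Lemma dot_eq0 x : dot x x = 0 -> x = 0.
Proof.
rewrite dot_sum => /eqP; rewrite psumr_eq0; last by move=> i _; rewrite -expr2 sqr_ge0.
move=> /allP x0; apply/rowP => i; rewrite mxE.
by have /= := x0 i (mem_index_enum _); rewrite mulf_eq0 orbb => /eqP.
Qed.

Lemma enorm_sqr x : enorm x ^+ 2 = dot x x.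
Proof. by rewrite sqr_sqrtr ?dot_ge0. Qed.

Lemma enorm_eq0 x : enorm x = 0 -> x = 0.
Proof. by move=> x0; apply: dot_eq0; rewrite -enorm_sqr x0 expr0n. Qed.

Lemma enorm_ge0 x : 0 <= enorm x.
Proof. exact: sqrtr_ge0. Qed.

Lemma enorm1 x : (enorm x = 1) <-> (dot x x = 1).
Proof.
split=> [x1|x1]; first by rewrite -enorm_sqr x1 expr1n.
by rewrite /enorm x1 sqrtr1.
Qed.

Lemma dot_unitv x : x != 0 -> dot (unitv x) (unitv x) = 1.
Proof.
move=> x0; have n0 : enorm x != 0 by apply: contra_neq x0; exact: enorm_eq0.
by rewrite /unitv !dotE -enorm_sqr; field.
Qed.

Lemma angle_unit x y : dot x x = 1 -> dot y y = 1 -> angle x y = acos (dot x y).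
Proof. by move=> /enorm1 x1 /enorm1 y1; rewrite /angle x1 y1 mulr1 divr1. Qed.

Lemma dot_unit_bounds x y :
  dot x x = 1 -> dot y y = 1 -> -1 <= dot x y <= 1.
Proof.
move=> x1 y1; have := dot_ge0 (x + y); have := dot_ge0 (x - y).
by rewrite !dotE x1 y1 (dotC y x); lra.
Qed.

End Dot.

(** * Directions in barycentric coordinates and flat charts *)

Section Barycentric.
Context {R : realType} {V : nat}.
Implicit Types (s h : {set 'I_V}) (l : 'I_V -> 'I_V -> R) (c d : 'rV[R]_V).

(** The vectors parallel to the simplex s: the coordinates of a difference of
    two of its points vanish off s and have sum 0.  The vector of E^m that
    a chart [p] gives to [c] is [c *m p]. *)
Definition direction s c : Prop :=
  (forall v, v \notin s -> c 0 v = 0) /\ \sum_v c 0 v = 0.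

Lemma directionD s c d : direction s c -> direction s d -> direction s (c + d).
Proof.
move=> [cs c0] [ds d0]; split=> [v vs|]; first by rewrite mxE cs ?ds ?addr0.
by under eq_bigr do rewrite mxE; rewrite big_split/= c0 d0 addr0.
Qed.

Lemma directionZ s a c : direction s c -> direction s (a *: c).
Proof.
move=> [cs c0]; split=> [v vs|]; first by rewrite mxE cs ?mulr0.
by under eq_bigr do rewrite mxE; rewrite -mulr_sumr c0 mulr0.
Qed.

Lemma directionN s c : direction s c -> direction s (- c).
Proof. by rewrite -scaleN1r; exact: directionZ. Qed.

Lemma directionS s h c : h \subset s -> direction h c -> direction s c.
Proof.
move=> /fintype.subsetP hs [ch c0]; split=> // v vs; apply: ch.
by apply: contraNN vs; exact: hs.
Qed.

Lemma direction_face h a c : direction (a |: h) c -> c 0 a = 0 -> direction h c.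
Proof.
move=> [cs c0] ca; split=> // v vh; have [->//|va] := eqVneq v a.
by apply: cs; rewrite !inE (negbTE va).
Qed.

Lemma direction_vertices s v w : v \in s -> w \in s ->
  direction s (delta_mx 0 v - delta_mx 0 w).
Proof.
move=> vs ws; split=> [z zs|].
  have zv : z == v = false by apply: contraNF zs => /eqP ->.
  have zw : z == w = false by apply: contraNF zs => /eqP ->.
  by rewrite !mxE zv zw !andbF subrr.
have sum1 z : \sum_i (delta_mx 0 z : 'rV[R]_V) 0 i = 1.
  rewrite (bigD1 z)//= big1 ?mxE ?eqxx ?addr0// => i iz.
  by rewrite mxE (negbTE iz) andbF.
under eq_bigr do rewrite mxE [X in _ + X]mxE.
by rewrite big_split/= sumrN !sum1 subrr.
Qed.

Lemma vertices_mul m (p : 'M[R]_(V, m)) v w :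
  (delta_mx 0 v - delta_mx 0 w) *m p = pos p v - pos p w.
Proof. by rewrite mulmxBl -!rowE. Qed.

Lemma direction_mul m (p : 'M[R]_(V, m)) s c w : direction s c ->
  c *m p = \sum_v c 0 v *: (pos p v - pos p w).
Proof.
move=> [_ c0]; under eq_bigr do rewrite scalerBr.
by rewrite sumrB -scaler_suml c0 scale0r subr0 mulmx_sum_row.
Qed.

Definition normal_to (m : nat) s (p : 'M[R]_(V, m)) (x : 'rV[R]_m) : Prop :=
  forall v w, v \in s -> w \in s -> dot x (pos p v - pos p w) = 0.

(** All vertices of h project to the same point on the line of x, so only the
    apex a contributes. *)
Lemma dot_direction_apex m (p : 'M[R]_(V, m)) h a c w x :
  direction (a |: h) c -> w \in h -> normal_to h p x ->
  dot x (c *m p) = c 0 a * dot x (pos p a - pos p w).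
Proof.
move=> dc wh xh; rewrite (direction_mul p w dc) dot_sumr.
rewrite (big_only1 a)// => [|v va _]; first by rewrite dotZr.
rewrite dotZr; have [vh|vh] := boolP (v \in h); first by rewrite xh ?mulr0.
by case: dc => -> //; rewrite ?mul0r// !inE negb_or va.
Qed.

Lemma dot_direction m (p : 'M[R]_(V, m)) s c x :
  direction s c -> normal_to s p x -> dot x (c *m p) = 0.
Proof.
move=> dc xs; have [w ws|s0] := pickP [in s].
  rewrite (@dot_direction_apex _ p s w c w) ?subrr ?dot0r ?mulr0//.
  by apply: directionS dc; exact: finset.subsetUr.
have -> : c = 0; last by rewrite mul0mx dot0r.
by apply/rowP => v; rewrite mxE; case: dc => -> //; exact/negbT/s0.
Qed.

Lemma normal_to_sub m s h (p : 'M[R]_(V, m)) x :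
  h \subset s -> normal_to s p x -> normal_to h p x.
Proof. by move=> /fintype.subsetP hs xs v w vh wh; apply: xs; exact: hs. Qed.

(** Expanding |p_v - p_w|^2, the two terms that depend on one vertex only are
    killed by the vanishing of the coordinate sums. *)
Lemma dot_direction_lengths m (p : 'M[R]_(V, m)) s c d :
  direction s c -> direction s d ->
  dot (c *m p) (d *m p) =
    - (\sum_v \sum_w c 0 v * d 0 w * enorm (pos p v - pos p w) ^+ 2) / 2.
Proof.
move=> [_ c0] [_ d0].
under eq_bigr => v _.
  under eq_bigr => w _.
    rewrite enorm_sqr !dotE (dotC (pos p w)).
    rewrite (_ : _ * _ = c 0 v * dot (pos p v) (pos p v) * d 0 w
      + c 0 v * (d 0 w * dot (pos p w) (pos p w))
      - 2 * (c 0 v * (d 0 w * dot (pos p v) (pos p w)))); last by ring.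
    over.
  rewrite sumrB big_split/= -!mulr_sumr d0 mulr0 add0r.
  over.
rewrite sumrB -mulr_suml c0 mul0r sub0r -mulr_sumr.
rewrite !mulmx_sum_row dot_suml opprK [RHS]mulrC mulKf//.
apply: eq_bigr => v _; rewrite dotZl dot_sumr; congr (_ * _).
by apply: eq_bigr => w _; rewrite dotZr.
Qed.

Definition has_lengths l m s (p : 'M[R]_(V, m)) : Prop :=
  forall v w, v \in s -> w \in s -> enorm (pos p v - pos p w) = l v w.

(** The edge-lengths of a simplex determine its metric.  This transports the
    intrinsic data of the unfolding into E^n to the charts in E^(n+1). *)
Lemma dot_isometry l m m' (p : 'M[R]_(V, m)) (q : 'M[R]_(V, m')) s c d :
  has_lengths l s p -> has_lengths l s q -> direction s c -> direction s d ->
  dot (c *m p) (d *m p) = dot (c *m q) (d *m q).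
Proof.
move=> ps qs dc dd; rewrite !(@dot_direction_lengths _ _ s)//.
congr (- _ / 2); apply: eq_bigr => v _; apply: eq_bigr => w _.
have [vs|vs] := boolP (v \in s); last by case: dc => -> //; rewrite !mul0r.
have [ws|ws] := boolP (w \in s); last by case: dd => -> //; rewrite mulr0 !mul0r.
by rewrite ps// qs.
Qed.

Lemma enorm_isometry l m m' (p : 'M[R]_(V, m)) (q : 'M[R]_(V, m')) s c :
  has_lengths l s p -> has_lengths l s q -> direction s c ->
  enorm (c *m p) = enorm (c *m q).
Proof. by move=> ps qs dc; rewrite /enorm (dot_isometry ps qs). Qed.

(** Affine independence is the nondegeneracy of the scalar product on the
    directions, hence it only depends on the edge-lengths. *)
Lemma flat_chart_isometry l m m' (p : 'M[R]_(V, m)) (q : 'M[R]_(V, m')) s :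
  has_lengths l s p -> flat_chart l s q -> flat_chart l s p.
Proof.
move=> ps [qs qind]; split=> // c cs c0 cp.
apply: qind => //; apply: dot_eq0.
by rewrite -(dot_isometry ps qs)// cp dot0l.
Qed.

Lemma flat_chart_sub l m (p : 'M[R]_(V, m)) s h :
  h \subset s -> flat_chart l s p -> flat_chart l h p.
Proof.
move=> hs [ps pind]; have /fintype.subsetP hs' := hs; split=> [v w vh wh|c ch c0].
  by apply: ps; exact: hs'.
by apply: pind => // v vs; apply: ch; apply: contraNN vs; exact: hs'.
Qed.

Lemma flat_chart_ind l m (p : 'M[R]_(V, m)) s c :
  flat_chart l s p -> direction s c -> c *m p = 0 -> c = 0.
Proof. by move=> [_ pind] [cs c0]; exact: pind. Qed.

Definition edges (m : nat) s (a : 'I_V) (p : 'M[R]_(V, m)) : 'M[R]_(#|s|, m) :=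
  \matrix_(i < #|s|) (pos p (enum_val i) - pos p a).

(** The rows are the barycentric coordinates of the vectors listed by [edges]. *)
Definition edge_coefs s (a : 'I_V) : 'M[R]_(#|s|, V) :=
  \matrix_(i < #|s|) (delta_mx 0 (enum_val i) - delta_mx 0 a).

Lemma edges_coefs m s a (p : 'M[R]_(V, m)) : edges s a p = edge_coefs s a *m p.
Proof. by apply/row_matrixP => i; rewrite row_mul !rowK vertices_mul. Qed.

Lemma direction_edges h a (y : 'rV[R]_#|h|) :
  direction (a |: h) (y *m edge_coefs h a).
Proof.
rewrite mulmx_sum_row; elim/big_ind: _ => [|c d|i _].
- by split=> [v _|]; rewrite ?mxE// big1// => v _; rewrite mxE.
- exact: directionD.
- rewrite rowK; apply/directionZ/direction_vertices;
    by rewrite !inE ?eqxx ?enum_valP ?orbT.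
Qed.

Lemma edges_row_free l m (p : 'M[R]_(V, m)) h a : a \notin h ->
  flat_chart l (a |: h) p -> row_free (edges h a p).
Proof.
move=> ah pf; apply: inj_row_free => y.
rewrite edges_coefs mulmxA => /(flat_chart_ind pf (direction_edges _ _)) y0.
apply/rowP => i; move/rowP: y0 => /(_ (enum_val i)).
rewrite [LHS]mxE !mxE (bigD1 i)//= big1 => [|j ji]; last first.
  rewrite !mxE /= (inj_eq enum_val_inj) eq_sym (negbTE ji).
  rewrite (_ : _ == a = false) ?subr0 ?mulr0//.
  by apply: contraNF ah => /eqP <-; exact: enum_valP.
rewrite !mxE !eqxx/= addr0 (_ : _ == a = false) ?subr0 ?mulr1//.
by apply: contraNF ah => /eqP <-; exact: enum_valP.
Qed.

Lemma flat_chart_span l m (p : 'M[R]_(V, m)) h a x : a \notin h -> #|h| = m ->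
  flat_chart l (a |: h) p -> exists2 c, direction (a |: h) c & c *m p = x.
Proof.
move=> ah hm pf; have rf := edges_row_free ah pf.
have /submxP[y ->] : (x <= edges h a p)%MS.
  by rewrite submx_full// /row_full -[X in _ == X]hm.
by exists (y *m edge_coefs h a); rewrite ?edges_coefs ?mulmxA//; exact: direction_edges.
Qed.

(** The edges of a facet at a and its unit normal N are n + 1 linearly independent
    vectors, so only 0 is orthogonal to all of them. *)
Lemma normal_line l m (p : 'M[R]_(V, m)) h a N z : a \notin h -> #|h|.+1 = m ->
  flat_chart l (a |: h) p -> unit_normal (a |: h) p N ->
  normal_to (a |: h) p z -> dot z N = 0 -> z = 0.
Proof.
move=> ah hm pf [/enorm1 N1 Nh] zh zN.
have edge0 x : normal_to (a |: h) p x -> forall y, dot x (y *m edges h a p) = 0.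
  move=> xh y; rewrite edges_coefs mulmxA.
  by apply: dot_direction xh; exact: direction_edges.
have rf : row_free (col_mx N (edges h a p)).
  apply: inj_row_free => v; rewrite -[v]hsubmxK mul_row_col.
  set y0 := lsubmx v; set y := rsubmx v => yN.
  have y00 : y0 0 0 = 0.
    move: (congr1 (dot N) yN); rewrite dotDr edge0// dot0r addr0.
    by rewrite {1}[y0]mx11_scalar mul_scalar_mx dotZr N1 mulr1.
  move: yN; rewrite [y0]mx11_scalar y00 mul_scalar_mx scale0r add0r => yN.
  have -> : y = 0.
    by apply: (row_free_inj (edges_row_free ah pf)); rewrite mul0mx.
  by rewrite -[0%:M]scalemx1 scale0r row_mx0.
have /submxP[b zb] : (z <= col_mx N (edges h a p))%MS.
  by rewrite submx_full// /row_full -[X in _ == X]hm.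
apply: dot_eq0; rewrite {2}zb -[b]hsubmxK mul_row_col dotDr edge0// addr0.
by rewrite [lsubmx b]mx11_scalar mul_scalar_mx dotZr zN mulr0.
Qed.

End Barycentric.

(** * The plane orthogonal to a hinge *)

Section HingePlane.
Context {R : realType} {V n : nat}.
Implicit Types (h : {set 'I_V}) (l : 'I_V -> 'I_V -> R) (p : 'M[R]_(V, n.+1)).

(** The plane orthogonal to the hinge h carries two orthonormal vectors attached
    to the facet [a |: h]: the conormal [c *m p], tangent to the facet, and the
    normal N.  The conormal is recorded by its barycentric coordinates [c]
    because these do not depend on the chart; the sign of [c 0 a] tells whether
    it leaves the facet through the hinge (negative) or enters it. *)
Definition hinge_frame l p h a (c : 'rV[R]_V) (N : 'rV[R]_n.+1) : Prop :=
  [/\ flat_chart l (a |: h) p, direction (a |: h) c,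
      dot (c *m p) (c *m p) = 1, normal_to h p (c *m p)
    & unit_normal (a |: h) p N].

Section Frame.
Context (l : 'I_V -> 'I_V -> R) (p : 'M[R]_(V, n.+1)) (h : {set 'I_V}).
Context (a : 'I_V) (c : 'rV[R]_V) (N : 'rV[R]_n.+1).
Context (ah : a \notin h) (hn : #|h| = n) (F : hinge_frame l p h a c N).
Let e := c *m p.

Lemma frame_apex_neq0 : c 0 a != 0.
Proof.
case: F => _ dc e1 eh _; apply/eqP => ca.
have := dot_direction (direction_face dc ca) eh.
by rewrite e1 => /eqP; rewrite oner_eq0.
Qed.

Lemma frame_normal_hinge : normal_to h p N.
Proof. by case: F => _ _ _ _ [_]; apply: normal_to_sub; exact: finset.subsetUr. Qed.

Lemma frame_normal_conormal : dot N e = 0.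
Proof. by case: F => _ dc _ _ [_]; exact: dot_direction. Qed.

Lemma frame_normal_unit : dot N N = 1.
Proof. by case: F => _ _ _ _ [/enorm1]. Qed.

(** The orthogonal complement of a hinge is a plane: removing from x its
    components along the conormal and the normal leaves a vector orthogonal to
    the facet and to N. *)
Lemma frame_expand x : normal_to h p x -> x = dot x e *: e + dot x N *: N.
Proof.
move=> xh; have [pf dc e1 eh NU] := F.
have Ne := frame_normal_conormal; have N1 := frame_normal_unit.
pose z := x - (dot x e *: e + dot x N *: N).
have zh : normal_to h p z.
  by move=> v w vh wh; rewrite !(dotDl, dotNl, dotZl) xh// eh// frame_normal_hinge//; ring.
have ze : dot z e = 0 by rewrite !dotE e1 Ne; ring.
have zN : dot z N = 0 by rewrite !dotE (dotC e) N1 Ne; ring.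
apply/eqP; rewrite -subr_eq0; apply/eqP; apply: (normal_line ah) NU _ zN.
- by rewrite hn.
- exact: pf.
move=> v w vs ws; rewrite -vertices_mul; set d := _ - _.
have dd : direction (a |: h) d by exact: direction_vertices.
rewrite -[d](subrK ((d 0 a / c 0 a) *: c)) mulmxDl -scalemxAl dotDr dotZr ze mulr0.
rewrite addr0; apply: dot_direction zh; apply: (@direction_face _ _ _ a).
  by apply: directionD => //; apply/directionN/directionZ.
by rewrite !mxE divfK ?subrr// frame_apex_neq0.
Qed.

Lemma frame_dot x y : normal_to h p x ->
  dot x y = dot x e * dot y e + dot x N * dot y N.
Proof.
by move=> xh; rewrite {1}(frame_expand xh) !dotE (dotC y) (dotC y).
Qed.

Lemma frame_apex x w : w \in h -> normal_to h p x ->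
  dot x e = c 0 a * dot x (pos p a - pos p w).
Proof. by move=> wh; case: F => _ dc _ _ _; exact: dot_direction_apex. Qed.

End Frame.

Section TwoFrames.
Context (l : 'I_V -> 'I_V -> R) (p : 'M[R]_(V, n.+1)) (h : {set 'I_V}).
Context (a b : 'I_V) (c d : 'rV[R]_V) (N1 N2 : 'rV[R]_n.+1).
Context (ah : a \notin h) (hn : #|h| = n).
Context (F1 : hinge_frame l p h a c N1) (F2 : hinge_frame l p h b d N2).
Let e1 := c *m p.
Let e2 := d *m p.

(** The determinant of the change of basis from (N1, e1) to (N2, e2). *)
Definition orientation_sign : R := dot N1 N2 * dot e1 e2 - dot N1 e2 * dot e1 N2.

(** Both bases are orthonormal, so the transition matrix is a rotation or a
    reflection and its second row is determined by the first and by its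
    determinant. *)
Lemma frames_transition :
  [/\ dot N1 N2 = orientation_sign * dot e1 e2,
      dot e1 N2 = - orientation_sign * dot N1 e2 & orientation_sign ^+ 2 = 1].
Proof.
have h2 : normal_to h p e2 by case: F2.
have hN2 := frame_normal_hinge F2.
have := frame_dot ah hn F1 e2 h2; have := frame_dot ah hn F1 N2 hN2.
have := frame_dot ah hn F1 e2 hN2.
rewrite (frame_normal_unit F2) (frame_normal_conormal F2).
have -> : dot e2 e2 = 1 by case: F2.
rewrite -/e1 /orientation_sign !(dotC _ e1) !(dotC _ N1).
move: (dot e1 N2) (dot N1 N2) (dot e1 e2) (dot N1 e2) => S' C' C S e0 e3 e4.
split.
- transitivity (C' * (C * C + S * S) - S * (S' * C + C' * S)); last by ring.
  by rewrite -e0 -e4; ring.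
- transitivity (S' * (C * C + S * S) - C * (S' * C + C' * S)); last by ring.
  by rewrite -e0 -e4; ring.
transitivity ((S' * S' + C' * C') * (C * C + S * S) - (S' * C + C' * S) ^+ 2).
  by ring.
by rewrite -e0 -e3 -e4; ring.
Qed.

(** If the normals are coherently oriented, then the rotation that carries one
    conormal to the other also carries one normal to the other. *)
Lemma frames_coherent : 0 < orientation_sign -> dot N1 N2 = dot e1 e2.
Proof.
have [C' _ /eqP] := frames_transition; rewrite sqrf_eq1 => /orP[]/eqP s1.
  by rewrite C' s1 mul1r.
by rewrite s1 oppr_gt0 ltr10.
Qed.

End TwoFrames.

End HingePlane.

(** * Coherent normals on an oriented hypersurface *)

Lemma det_scalar_blocks (R : comNzRingType) (a b c d : R) :
  \det (block_mx a%:M b%:M c%:M d%:M : 'M[R]_(1 + 1)) = a * d - b * c.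
Proof.
set M : 'M[R]_(1 + 1) := block_mx _ _ _ _.
pose i0 : 'I_(1 + 1) := lshift 1 0; pose i1 : 'I_(1 + 1) := rshift 1 0.
have M00 : M i0 i0 = a by rewrite /M block_mxEul mxE.
have M01 : M i0 i1 = b by rewrite /M block_mxEur mxE.
have M10 : M i1 i0 = c by rewrite /M block_mxEdl mxE.
have M11 : M i1 i1 = d by rewrite /M block_mxEdr mxE.
have l0 : lift i0 0 = i1 by exact/val_inj.
have l1 : lift i1 0 = i0 by exact/val_inj.
clearbody M.
rewrite (expand_det_row _ i0) big_split_ord/= !big_ord1 -/i0 -/i1 M00 M01.
by rewrite /cofactor !det_mx11 !mxE l0 l1 M10 M11 /= expr0 expr1 mul1r mulN1r mulrN.
Qed.

Section EuclideanOrientation.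
Context {R : realType} {V n : nat}.
Context (l : 'I_V -> 'I_V -> R) (p : 'M[R]_(V, n.+2)) (h : {set 'I_V}).
Context (w : 'I_n.+1 -> 'I_V).

Let W : 'M[R]_(n, n.+2) :=
  \matrix_(i < n) (pos p (w (lift ord0 i)) - pos p (w ord0)).

(** Subtracting the first edge from the others leaves vectors of the hinge, which
    are common to the two facets. *)
Lemma det_apex_frame (N : 'rV[R]_n.+2) v :
  \det (col_mx N (\matrix_(i < n.+1) (pos p (w i) - pos p v)) : 'M[R]_(1 + n.+1)) =
  \det (col_mx N (col_mx (pos p (w ord0) - pos p v) W) : 'M[R]_(1 + (1 + n))).
Proof.
pose L : 'M[R]_(1 + (1 + n)) := block_mx 1 0 0 (block_mx 1 0 (const_mx 1) 1).
have detL : \det L = 1 by rewrite /L !det_lblock !det1 !mulr1.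
rewrite -[RHS]mul1r -detL -det_mulmx; congr (\det _).
rewrite /L mul_block_col mul1mx mul0mx addr0 mul0mx add0r mul_block_col.
rewrite !mul1mx mul0mx addr0; congr (col_mx _ _).
apply/row_matrixP => i; rewrite rowK; case: (unliftP ord0 i) => [j|] ->.
  rewrite (_ : lift ord0 j = rshift 1 j); last exact/val_inj.
  rewrite [RHS](@rowKd _ 1 n) linearD/= row_mul row_const rowK.
  rewrite [const_mx 1]mx11_scalar mul_scalar_mx mxE scale1r.
  rewrite (_ : lift ord0 j = rshift 1 j); last exact/val_inj.
  by rewrite [RHS]addrC addrA subrK.
rewrite [X in row X _](_ : ord0 = lshift n (0 : 'I_1)); last exact/val_inj.
by rewrite [RHS](@rowKu _ 1 n) row_id.
Qed.

(** The Gram matrix of the two frames is block triangular because the vectors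
    N1 and e1 are orthogonal to the hinge. *)
Lemma det_pair_gram (N x N1 e1 : 'rV[R]_n.+2) :
  (forall i, dot N1 (row i W) = 0) -> (forall i, dot e1 (row i W) = 0) ->
  \det (col_mx N (col_mx x W) : 'M[R]_(1 + (1 + n))) *
  \det (col_mx N1 (col_mx e1 W) : 'M[R]_(1 + (1 + n))) =
  (dot N N1 * dot x e1 - dot N e1 * dot x N1) * \det (W *m W^T).
Proof.
move=> N1W e1W.
have assoc (y z : 'rV[R]_n.+2) :
    col_mx y (col_mx z W) = col_mx (col_mx y z) W :> 'M[R]_(1 + (1 + n), n.+2).
  by rewrite col_mxA castmx_id.
rewrite !assoc -(det_tr (col_mx (col_mx N1 e1) W : 'M[R]_(1 + 1 + n))).
rewrite -det_mulmx tr_col_mx.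
rewrite (mul_col_row (m1 := 1 + 1) (p1 := 1 + 1)).
have mul_tr (y z : 'rV[R]_n.+2) : y *m z^T = (dot y z)%:M by exact: mx11_scalar.
rewrite (_ : W *m (col_mx N1 e1)^T = 0); last first.
  rewrite tr_col_mx mul_mx_row -[RHS]row_mx0; congr row_mx; apply/row_matrixP => i.
    by rewrite row_mul mul_tr dotC N1W raddf0 row0.
  by rewrite row_mul mul_tr dotC e1W raddf0 row0.
rewrite (det_ublock (n1 := 1 + 1)); congr (_ * _).
rewrite tr_col_mx mul_col_row !mul_tr.
exact: det_scalar_blocks.
Qed.

(** Up to squares of Gram and frame determinants, the product of the two
    determinants is that of the coordinate determinants of
    (N1, w_0 - a) and (N2, w_0 - b) in the basis (N1, e1).  The conormal e1 is a
    positive multiple of w_0 - a modulo the hinge and e2 a negative multiple of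
    w_0 - b, so a negative product means a positive [orientation_sign]. *)
Lemma orientation_frames (a b : 'I_V) (c d : 'rV[R]_V) (N1 N2 : 'rV[R]_n.+2) :
  a \notin h -> b \notin h -> #|h| = n.+1 ->
  hinge_frame l p h a c N1 -> hinge_frame l p h b d N2 -> c 0 a < 0 -> 0 < d 0 b ->
  injective w -> (forall i, w i \in h) ->
  \det (col_mx N1 (\matrix_(i < n.+1) (pos p (w i) - pos p a)) : 'M[R]_(1 + n.+1)) *
  \det (col_mx N2 (\matrix_(i < n.+1) (pos p (w i) - pos p b)) : 'M[R]_(1 + n.+1)) < 0 ->
  dot N1 N2 = dot (c *m p) (d *m p).
Proof.
move=> ah bh hn F1 F2 ca db winj wh.
have h1 : normal_to h p (c *m p) by case: F1.
have h2 : normal_to h p (d *m p) by case: F2.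
have hN1 := frame_normal_hinge F1; have hN2 := frame_normal_hinge F2.
have rowW x : normal_to h p x -> forall i, dot x (row i W) = 0.
  by move=> xh i; rewrite rowK xh.
rewrite !det_apex_frame.
set xa := pos p (w ord0) - pos p a; set xb := pos p (w ord0) - pos p b.
set Da := \det _; set Db := \det _ => Dab.
apply: (frames_coherent ah hn F1 F2).
have := @det_pair_gram N1 xa _ _ (rowW _ hN1) (rowW _ h1).
have := @det_pair_gram N2 xb _ _ (rowW _ hN1) (rowW _ h1).
set G := \det (W *m W^T); set q := \det (col_mx N1 (col_mx (c *m p) W)).
rewrite -/Da -/Db (frame_normal_unit F1) (frame_normal_conormal F1).
rewrite mul0r subr0 mul1r => eb ea.
(* A vector in the kernel is orthogonal to the hinge, to N1 and to e1. *)
have q0 : q != 0.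
  rewrite /q -det_tr; apply/negP => /det0P[v v0].
  rewrite tr_col_mx mul_mx_row tr_col_mx mul_mx_row => /eqP.
  rewrite !row_mx_eq0 => /and3P[vN ve vW].
  have dot_tr (y z : 'rV[R]_n.+2) : y *m z^T == 0 -> dot y z = 0.
    by move=> /eqP; rewrite /dot => ->; rewrite mxE.
  have hw u : u \in h -> exists i, u = w i.
    have -> : h = [set w i | i : 'I_n.+1]%SET.
      apply/esym/eqP; rewrite eqEcard card_imset// card_ord hn leqnn andbT.
      by apply/fintype.subsetP => _ /imsetP[i _ ->].
    by move=> /imsetP[i _ ->]; exists i.
  have vw i : dot v (pos p (w i) - pos p (w ord0)) = 0.
    have [j ->|->] := unliftP ord0 i; last by rewrite subrr dot0r.
    have := @dot_tr v (row j W); rewrite tr_row colE mulmxA (eqP vW) mul0mx eqxx.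
    by move=> /(_ isT); rewrite rowK.
  have vh : normal_to h p v.
    move=> _ _ /hw[i ->] /hw[j ->].
    by have := vw i; have := vw j; rewrite !(dotDr, dotNr); lra.
  move/negP: v0; apply; apply/eqP.
  by rewrite (frame_expand ah hn F1 vh) !dot_tr// !scale0r addr0.
have ae : 0 < dot xa (c *m p).
  have := frame_apex F1 (wh ord0) h1; have [_ _ -> _ _] := F1.
  have -> : pos p a - pos p (w ord0) = - xa by rewrite opprB.
  rewrite dotNr dotC; nra.
have eb' y : normal_to h p y -> dot (d *m p) y = - (d 0 b * dot xb y).
  move=> yh; rewrite dotC (frame_apex F2 (wh ord0) yh).
  by rewrite -opprB dotNr mulrN dotC.
rewrite /orientation_sign [dot (c *m p) _]dotC eb'// [dot N1 (d *m p)]dotC eb'//.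
set T := _ - _ in eb.
have T0 : T < 0.
  rewrite ltNge; apply/negP => T0.
  have : 0 <= (T * G) * (dot xa (c *m p) * G).
    by rewrite mulrACA -expr2 mulr_ge0 ?sqr_ge0// mulr_ge0// ltW.
  rewrite -eb -ea mulrACA -expr2 pmulr_lge0 ?exprn_even_gt0//=.
  by rewrite mulrC leNgt Dab.
have -> : dot N1 N2 * - (d 0 b * dot xb (c *m p)) -
    - (d 0 b * dot xb N1) * dot (c *m p) N2 = - (d 0 b * T).
  by rewrite /T (dotC N1) (dotC _ N2); ring.
by rewrite oppr_gt0 pmulr_rlt0.
Qed.

End EuclideanOrientation.

(** * Coherent normals in a development around a hinge *)

Section Development.
Context {R : realType} {V n : nat}.
Context (l : 'I_V -> 'I_V -> R) (p : 'M[R]_(V, n.+1)) (h : {set 'I_V}).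
Context (a : 'I_V) (c : 'rV[R]_V) (N1 : 'rV[R]_n.+1).
Context (ah : a \notin h) (hn : #|h| = n) (F1 : hinge_frame l p h a c N1).
Let e1 := c *m p.

(** Oriented area, in the plane orthogonal to h, of the projections of x and y. *)
Definition plane_area (x y : 'rV[R]_n.+1) : R :=
  dot x e1 * dot y N1 - dot x N1 * dot y e1.

Let arm w v := pos p v - pos p w.

(** The arms of v and v'' lie on opposite sides of the face spanned by v' and h,
    to which mu is normal, so the turns from v to v' and from v' to v'' have the
    same sense.  The nonzero area excludes that the arm of v' projects to 0. *)
Lemma plane_area_step w v v' v'' mu : w \in h ->
  unfolding l (v' |: h) v v'' p mu ->
  plane_area (arm w v) (arm w v') != 0 ->
  0 < plane_area (arm w v) (arm w v') * plane_area (arm w v') (arm w v'').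
Proof.
move=> wh [_ _ /enorm1 mu1 muh side].
have whv' : w \in v' |: h by rewrite !inE wh orbT.
have muh' : normal_to h p mu.
  by apply: normal_to_sub muh; exact: finset.subsetUr.
have /andP[] := side _ whv'; rewrite -/(arm w v) -/(arm w v'').
have : dot mu (arm w v') = 0 by apply: muh; rewrite // !inE eqxx.
have mudot := frame_dot ah hn F1 _ muh'.
rewrite (mudot (arm w v)) (mudot (arm w v')) (mudot (arm w v'')).
move: mu1; rewrite mudot -/e1 /plane_area.
move: (dot mu e1) (dot mu N1) => m1 m2.
move: (dot (arm w v) e1) (dot (arm w v) N1) => x1 x2.
move: (dot (arm w v') e1) (dot (arm w v') N1) => y1 y2.
move: (dot (arm w v'') e1) (dot (arm w v'') N1) => z1 z2.
move=> m12 my mx mz xy0.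
(* Multiply by mu . mu = 1 and expand both areas times m1 and m2; the terms
   in mu . y vanish. *)
have key : (x1 * y2 - x2 * y1) * (y1 * z2 - y2 * z1) =
    - ((y1 ^+ 2 + y2 ^+ 2) * ((m1 * x1 + m2 * x2) * (m1 * z1 + m2 * z2))).
  rewrite -[LHS]mulr1 -m12.
  transitivity (
    (y2 * (m1 * x1 + m2 * x2) - x2 * (m1 * y1 + m2 * y2)) *
    (z2 * (m1 * y1 + m2 * y2) - y2 * (m1 * z1 + m2 * z2)) +
    (x1 * (m1 * y1 + m2 * y2) - y1 * (m1 * x1 + m2 * x2)) *
    (y1 * (m1 * z1 + m2 * z2) - z1 * (m1 * y1 + m2 * y2))); first by ring.
  by rewrite my; ring.
rewrite key oppr_gt0 pmulr_rlt0 ?pmulr_llt0//.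
rewrite lt0r addr_ge0 ?sqr_ge0// andbT paddr_eq0 ?sqr_ge0// !sqrf_eq0.
by apply: contra xy0 => /andP[/eqP -> /eqP ->]; rewrite !mulr0 subrr.
Qed.

End Development.

(** Around the hinge all successive turns have the same sense.  The normals are
    fixed by the side of the first simplex for N1 and of the last simplex for
    N2, that is, by the senses of the first and of the last turn; as these
    agree, the normals are coherent. *)
Lemma coherent_development (R : realType) (V n : nat) (l : 'I_V -> 'I_V -> R)
    T side e (h : {set 'I_V}) a b (C : hinge_chart R V n.+1) (c d : 'rV[R]_V) :
  (0 < n)%N -> a \notin h -> b \notin h -> #|h| = n ->
  hinge_frame l (place C) h a c (normal1 C) ->
  hinge_frame l (place C) h b d (normal2 C) ->
  c 0 a < 0 -> 0 < d 0 b ->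
  side_development l T side e h a b C ->
  dot (normal1 C) (normal2 C) = dot (c *m place C) (d *m place C).
Proof.
case: C => p N1 N2 /= n0 ah bh hn F1 F2 ca db.
move=> [r [v [[r0 va vr _] [[_ unf _ _] [/= n1 n2 d1 d2]]]]].
have [w wh] : exists w, w \in h by apply/card_gt0P; rewrite hn.
have h1 : normal_to h p (c *m p) by case: F1.
have h2 : normal_to h p (d *m p) by case: F2.
have hN1 := frame_normal_hinge F1.
pose arm u := pos p u - pos p w.
have dot_arm N u z : unit_normal (u |: h) p N -> dot N (pos p z - pos p u) = dot N (arm z).
  move=> [_ Nh]; have := Nh u w; rewrite !inE eqxx wh orbT => /(_ isT isT).
  by rewrite /arm !(dotDr, dotNr); lra.
have d1' : 0 < (-1) ^+ (~~ e) * dot N1 (arm (v 1%N)) by rewrite -(dot_arm _ a).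
have d2' : 0 < (-1) ^+ (~~ e) * dot N2 (arm (v r.-1)) by rewrite -(dot_arm _ b).
have armaN : dot N1 (arm a) = 0.
  by case: n1 => _; apply; rewrite !inE ?eqxx ?wh ?orbT.
have armae : dot (c *m p) (arm a) < 0.
  have := frame_apex F1 wh h1; have [_ _ -> _ _] := F1; rewrite -/(arm a); nra.
pose area := plane_area p c N1.
have area0 : area (arm a) (arm (v 1%N)) = dot (c *m p) (arm a) * dot N1 (arm (v 1%N)).
  by rewrite /area /plane_area !(dotC (arm _)) armaN mul0r subr0.
have area0_neq0 : area (arm a) (arm (v 1%N)) != 0.
  rewrite area0; apply/eqP => /eqP; rewrite mulf_eq0 => /orP[]/eqP z0.
    by move: armae; rewrite z0 ltxx.
  by move: d1'; rewrite z0 mulr0 ltxx.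
have same_sign j : (j < r)%N ->
    0 < area (arm a) (arm (v 1%N)) * area (arm (v j)) (arm (v j.+1)).
  elim: j => [|j IH] jr; first by rewrite va -expr2 exprn_even_gt0.
  have {}IH := IH (ltnW jr); have [mu U] := unf j jr.
  have aj : area (arm (v j)) (arm (v j.+1)) != 0.
    by apply/eqP => aj; move: IH; rewrite aj mulr0 ltxx.
  have := plane_area_step ah hn F1 wh U aj; rewrite -/area => aj1.
  have := mulr_gt0 IH aj1; rewrite mulrA -(mulrA (area (arm a) _)) -expr2 -mulrA mulrCA.
  by rewrite pmulr_rgt0// exprn_even_gt0.
have := same_sign r.-1; rewrite prednK// vr => /(_ (leqnn r)).
rewrite area0 => last_sign.
apply: (frames_coherent ah hn F1 F2).
have [C' S' _] := frames_transition ah hn F1 F2.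
have hN2 := frame_normal_hinge F2.
have := frame_dot ah hn F1 (arm (v r.-1)) hN2.
rewrite !(dotC N2) C' S' in d2' *.
move: last_sign; rewrite /area /plane_area.
have e2e1 := frame_apex F2 wh h1; have e2N1 := frame_apex F2 wh hN1.
rewrite -/(arm b) in e2e1 e2N1.
rewrite !(dotC (arm b)) e2e1 e2N1.
move: (orientation_sign _ _ _ _ _) => s.
have := mulr_gt0 d1' d2'; rewrite mulrACA => prod_sides.
have {prod_sides} : 0 < dot N1 (arm (v 1%N)) * dot (arm (v r.-1)) N2.
  rewrite ltNge; apply/negP => le0; move: prod_sides; rewrite ltNge.
  by rewrite mulr_ge0_le0// -expr2 sqr_ge0.
move=> t12; rewrite -mulrA nmulr_rgt0// => t1L t2E.
rewrite ltNge; apply/negP => s0; move: t12; rewrite {}t2E ltNge => /negP; apply.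
move: t1L; set L := _ - _ => t1L.
rewrite [leLHS](_ : _ = - s * (d 0 b * (dot N1 (arm (v 1%N)) * L))); last first.
  by rewrite /L; ring.
by rewrite mulr_ge0_le0 ?oppr_ge0// mulr_ge0_le0 ?ltW.
Qed.

(** * A straight line across one hinge *)

Section Crossing.
Context {R : realType}.

(** Here e1, e2 are the conormals, z is the component of the path along the
    hinge, and k is the cosine of the angle from the path to the conormal.  As
    (t2 - t1) . N1 = k (e2 . N1) with k >= 0, the turn of the path and the hinge
    angle have the same sign. *)
Lemma signed_angle_bend m (N1 N2 e1 e2 z v : 'rV[R]_m) (k r : R) :
  dot N1 N1 = 1 -> dot N2 N2 = 1 -> dot e1 e1 = 1 -> dot e2 e2 = 1 ->
  dot N1 e1 = 0 -> dot N1 N2 = dot e1 e2 ->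
  dot z e1 = 0 -> dot z e2 = 0 -> dot z N1 = 0 -> dot z z = 1 - k ^+ 2 ->
  0 <= k <= 1 -> 0 < r -> dot e2 N1 = r * dot v N1 ->
  let phi := signed_angle N1 v N1 N2 in
  let t1 := k *: e1 + z in
  let t2 := k *: e2 + z in
  `|phi| <= 1 -> signed_angle N1 (t2 - t1) t1 t2 = bend k phi.
Proof.
move=> N11 N21 e11 e21 Ne1 coh ze1 ze2 zN zz k01 r0 vN phi t1 t2.
have t11 : dot t1 t1 = 1 by rewrite /t1 !dotE e11 (dotC e1 z) ze1 zz; ring.
have t21 : dot t2 t2 = 1 by rewrite /t2 !dotE e21 (dotC e2 z) ze2 zz; ring.
have t12 : dot t1 t2 = 1 - k ^+ 2 * (1 - dot N1 N2).
  by rewrite /t1 /t2 !dotE coh (dotC e1 z) ze1 ze2 zz; ring.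
have tN : dot (t2 - t1) N1 = k * (r * dot v N1).
  by rewrite /t1 /t2 !dotE -vN (dotC e1 N1) Ne1; ring.
have Cb := dot_unit_bounds N11 N21; have [ac cosac] := acos_def Cb.
rewrite /phi /signed_angle !angle_unit// t12 tN.
move: ac cosac; set x := acos (dot N1 N2) => ac cosac; rewrite -cosac.
have k0 : 0 <= k by case/andP: k01.
case: ifPn => [v0 phi1|].
  rewrite mulr_ge0 ?mulr_ge0 ?(ltW r0)// acos_bend//.
  by move: phi1; rewrite ler_norml; lra.
rewrite -ltNge => v0; rewrite normrN => x1.
rewrite acos_bend ?bendN//; last by move: x1; rewrite ler_norml; lra.
case: ifPn => // kv; suff -> : k = 0 by rewrite /bend mul0r asin0 mulr0 oppr0.
apply/eqP; rewrite eq_le k0 andbT leNgt; apply/negP => k1.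
by move: kv; rewrite leNgt pmulr_rlt0 ?pmulr_rlt0// v0.
Qed.

Context {V n : nat}.
Implicit Types (h : {set 'I_V}) (l : 'I_V -> 'I_V -> R).

(** The directions of a nondegenerate n-simplex fill E^n, so the normal to the
    hinge in the unfolding has barycentric coordinates. *)
Lemma conormal_exists l (u : 'M[R]_(V, n)) h a nu :
  a \notin h -> #|h| = n -> flat_chart l (a |: h) u -> enorm nu = 1 ->
  normal_to h u nu ->
  exists c, [/\ direction (a |: h) c, c *m u = nu &
    forall w, w \in h -> c 0 a * dot nu (pos u a - pos u w) = 1].
Proof.
move=> ah hn uf /enorm1 nu1 nuh; have [c dc cu] := flat_chart_span nu ah hn uf.
exists c; split=> // w wh.
by rewrite -(dot_direction_apex dc wh nuh) cu.
Qed.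

Lemma hinge_frame_of_unfolding l (u : 'M[R]_(V, n)) (p : 'M[R]_(V, n.+1)) h a nu c N :
  flat_chart l (a |: h) u -> enorm nu = 1 -> normal_to h u nu ->
  direction (a |: h) c -> c *m u = nu ->
  flat_chart l (a |: h) p -> unit_normal (a |: h) p N ->
  hinge_frame l p h a c N.
Proof.
move=> [lu _] /enorm1 nu1 nuh dc cu pf NU; have [lp _] := pf.
split=> //; first by rewrite (dot_isometry lp lu dc dc) cu.
move=> v w vh wh.
have dvw : direction (a |: h) (delta_mx 0 v - delta_mx 0 w : 'rV[R]_V).
  by apply: direction_vertices; rewrite !inE ?vh ?wh orbT.
by rewrite -vertices_mul (dot_isometry lp lu dc dvw) cu vertices_mul nuh.
Qed.

(** The two halves of the path have the same unit vector in the unfolding, hence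
    the same component along nu and, the hinge being nondegenerate, the same
    component along the hinge in barycentric coordinates. *)
Lemma straight_decomposition l (u : 'M[R]_(V, n)) h a b nu (x y c d : 'rV[R]_V) w :
  w \in h -> unfolding l h a b u nu ->
  direction (a |: h) x -> direction (b |: h) y ->
  direction (a |: h) c -> direction (b |: h) d -> c *m u = nu -> d *m u = nu ->
  unitv (x *m u) = unitv (y *m u) ->
  let k := dot (unitv (x *m u)) nu in
  exists z, [/\ direction h z, (enorm (x *m u))^-1 *: x = k *: c + z &
    (enorm (y *m u))^-1 *: y = k *: d + z].
Proof.
move=> wh [ufa ufb /enorm1 nu1 nuh side] dx dy dc dd cu du xy k.
have tangential v s g : direction (v |: h) s -> direction (v |: h) g ->
    g *m u = nu -> dot nu (pos u v - pos u w) != 0 ->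
    unitv (s *m u) = unitv (x *m u) ->
    direction h ((enorm (s *m u))^-1 *: s - k *: g).
  move=> ds dg gu v0 su; set z := _ - _.
  have dz : direction (v |: h) z.
    by apply: directionD; [exact: directionZ|exact/directionN/directionZ].
  apply: (direction_face dz); apply: (mulIf v0); rewrite mul0r.
  rewrite -(dot_direction_apex dz wh nuh) mulmxBl -!scalemxAl gu -/(unitv _) su.
  by rewrite dotDr dotNr (dotZr k) nu1 mulr1 dotC subrr.
have [/lt_eqF/negbT ua /gt_eqF/negbT ub] := andP (side _ wh).
have dza := tangential _ _ _ dx dc cu ua erefl.
have dzb := tangential _ _ _ dy dd du ub (esym xy).
exists ((enorm (x *m u))^-1 *: x - k *: c).
split=> //; first by rewrite addrC subrK.
suff -> : (enorm (x *m u))^-1 *: x - k *: c = (enorm (y *m u))^-1 *: y - k *: d.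
  by rewrite addrC subrK.
apply/eqP; rewrite -subr_eq0; apply/eqP.
apply: (flat_chart_ind (flat_chart_sub (finset.subsetUr [set a]%SET h) ufa)).
  by apply: directionD => //; exact: directionN.
by rewrite !mulmxBl -!scalemxAl cu du -!/(unitv _) xy subrr.
Qed.

End Crossing.

(** * The hinges crossed by a path *)

Section PathCrossing.
Context {R : realType} {V n : nat}.
Context (l : 'I_V -> 'I_V -> R) (S : {set {set 'I_V}}) (g : polygonal_path R V).
Context (u : nat -> 'M[R]_(V, n)) (nu : nat -> 'rV[R]_n).
Context (n0 : (0 < n)%N) (pure : forall s, s \in S -> #|s| = n.+1).
Context (gS : is_path S g) (gu : path_unfolding l g u nu).
Context (straight : intrinsically_straight g u).

Lemma open_simplex_sub (s t : {set 'I_V}) (x : 'rV[R]_V) :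
  s \subset t -> open_simplex s x -> simplex t x.
Proof.
move=> /fintype.subsetP st [[x0 xs x1] _]; split=> // v vt; apply: xs.
by apply: contraNN vt; exact: st.
Qed.

Lemma hinge_sub_facets i : (i < ncross g)%N ->
  [/\ leave g i \notin hinge g i, enter g i \notin hinge g i,
      leave g i |: hinge g i = facet g i & enter g i |: hinge g i = facet g i.+1].
Proof.
move=> ig; have [_ /(_ _ ig)[lf ef ->] _ _ _] := gS.
by rewrite /hinge finset.setD1K// !inE eqxx (negbTE ef) andbF.
Qed.

Lemma card_hinge i : (i < ncross g)%N -> #|hinge g i| = n.
Proof.
move=> ig; have [lh _ lf _] := hinge_sub_facets ig.
have [/(_ _ (ltnW ig))[/pure fn _] _ _ _ _] := gS.
by apply/succn_inj; rewrite -fn -lf cardsU1 lh.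
Qed.

Lemma path_nodes i : (i <= ncross g)%N ->
  simplex (facet g i) (node g i) /\ simplex (facet g i) (node g i.+1).
Proof.
move=> ig; have [_ _ g0 gn gi] := gS; split.
  case: i ig => [_|i ig]; first by case: g0.
  have [_ _ _ <-] := hinge_sub_facets ig.
  by apply: open_simplex_sub (gi _ ig); exact: finset.subsetUr.
move: ig; rewrite leq_eqVlt => /predU1P[->|ig]; first by case: gn.
have [_ _ <- _] := hinge_sub_facets ig.
by apply: open_simplex_sub (gi _ ig); exact: finset.subsetUr.
Qed.

Lemma direction_segment i : (i <= ncross g)%N -> direction (facet g i) (segment g i).
Proof.
move=> ig; have [[_ x0 x1] [_ y0 y1]] := path_nodes ig; split=> [v vs|].
  by rewrite !mxE x0 ?y0 ?subrr.
by under eq_bigr do rewrite mxE [X in _ + X]mxE; rewrite sumrB x1 y1 subrr.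
Qed.

Lemma segment_neq0 i : (i <= ncross g)%N -> segment g i != 0.
Proof. by move=> ig; have [/(_ _ ig)[_]] := gS; rewrite subr_eq0 eq_sym. Qed.

(** The path reaches the face opposite to this vertex, so its coordinate cannot
    increase; this is what makes cos theta nonnegative. *)
Lemma segment_leave_le0 i : (i < ncross g)%N -> segment g i 0 (leave g i) <= 0.
Proof.
move=> ig; have [[x0 _ _] _] := path_nodes (ltnW ig).
have [_ _ _ _ /(_ _ ig)[[_ y0 _] _]] := gS.
have [lh _ _ _] := hinge_sub_facets ig.
by rewrite !mxE y0// sub0r oppr_le0.
Qed.

Lemma cos_theta i : (i < ncross g)%N ->
  0 <= cos (theta g u nu i) <= 1 /\
  cos (theta g u nu i) = dot (unitv (segment g i *m u i)) (nu i).
Proof.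
move=> ig; have [ufa ufb nu1 nuh side] := gu ig.
have [lh eh lf ef] := hinge_sub_facets ig.
have [w wh] : exists w, w \in hinge g i by apply/card_gt0P; rewrite card_hinge.
have dx := direction_segment (ltnW ig); rewrite -lf in dx.
have xu0 : segment g i *m u i != 0.
  by apply: contra_neq (segment_neq0 (ltnW ig)); exact: flat_chart_ind ufa dx.
have k_ge0 : 0 <= dot (unitv (segment g i *m u i)) (nu i).
  rewrite /unitv dotZl mulr_ge0 ?invr_ge0 ?enorm_ge0// dotC.
  rewrite (dot_direction_apex dx wh nuh) mulr_le0 ?segment_leave_le0//.
  by have /andP[/ltW] := side w wh.
have := dot_unit_bounds (dot_unitv xu0) ((enorm1 _).1 nu1) => kb.
have k01 : 0 <= dot (unitv (segment g i *m u i)) (nu i) <= 1.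
  by rewrite k_ge0; case/andP: kb.
suff -> : cos (theta g u nu i) = dot (unitv (segment g i *m u i)) (nu i) by [].
rewrite /theta /angle nu1 mulr1 (_ : _ / _ = dot (unitv (segment g i *m u i)) (nu i)).
  by rewrite acosK// in_itv.
by rewrite /unitv dotZl mulrC.
Qed.

(** In a chart the unit tangents before and after the hinge are k e1 + z and
    k e2 + z with k = cos theta and e1, e2 the images of the common normal to
    the hinge in the unfolding, since charts preserve scalar products on each
    facet.  The coherence hypothesis is what the orientation of the normals
    supplies. *)
Lemma tangent_angle_bend (C : nat -> hinge_chart R V n.+1) i : (i < ncross g)%N ->
  flat_chart l (facet g i) (place (C i)) ->
  flat_chart l (facet g i.+1) (place (C i)) ->
  unit_normal (facet g i) (place (C i)) (normal1 (C i)) ->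
  unit_normal (facet g i.+1) (place (C i)) (normal2 (C i)) ->
  (forall c d,
    hinge_frame l (place (C i)) (hinge g i) (leave g i) c (normal1 (C i)) ->
    hinge_frame l (place (C i)) (hinge g i) (enter g i) d (normal2 (C i)) ->
    c 0 (leave g i) < 0 -> 0 < d 0 (enter g i) ->
    dot (normal1 (C i)) (normal2 (C i)) = dot (c *m place (C i)) (d *m place (C i))) ->
  `|hinge_angle g C i| <= 1 ->
  tangent_angle g C i = bend (cos (theta g u nu i)) (hinge_angle g C i).
Proof.
move=> ig; rewrite /tangent_angle /hinge_angle.
have [lh eh lf ef] := hinge_sub_facets ig; have hn := card_hinge ig.
have [k01 kE] := cos_theta ig; have U := gu ig; have xy := straight ig.
have dx := direction_segment (ltnW ig); have dy := direction_segment ig.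
have x0 := segment_neq0 (ltnW ig); have y0 := segment_neq0 ig.
move: dx dy; rewrite -lf -ef.
case: (C i) => p N1 N2 /= dx dy pa pb NU1 NU2 coh phi1.
have [w wh] : exists w, w \in hinge g i by apply/card_gt0P; rewrite hn.
have [ua ub nu1 nuh side] := U.
have [c [dc cu cw]] := conormal_exists lh hn ua nu1 nuh.
have [d [dd du dw]] := conormal_exists eh hn ub nu1 nuh.
have /andP[sa sb] := side w wh.
have ca : c 0 (leave g i) < 0 by have := cw w wh; nra.
have db : 0 < d 0 (enter g i) by have := dw w wh; nra.
have F1 := hinge_frame_of_unfolding ua nu1 nuh dc cu pa NU1.
have F2 := hinge_frame_of_unfolding ub nu1 nuh dd du pb NU2.
have {}coh := coh c d F1 F2 ca db.
have [z []] := straight_decomposition wh U dx dy dc dd cu du xy.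
rewrite -kE; set k := cos _ in k01 kE *; move=> dz xE yE.
have [lua _] := ua; have [lub _] := ub; have [lpa _] := pa; have [lpb _] := pb.
have xp : unitv (segment g i *m p) = k *: (c *m p) + z *m p.
  by rewrite /unitv (enorm_isometry lpa lua dx) !scalemxAl xE mulmxDl.
have yp : unitv (segment g i.+1 *m p) = k *: (d *m p) + z *m p.
  by rewrite /unitv (enorm_isometry lpb lub dy) !scalemxAl yE mulmxDl.
have [_ _ e11 eh1 _] := F1; have [_ _ e21 eh2 _] := F2.
have hN1 := frame_normal_hinge F1.
have ze1 : dot (z *m p) (c *m p) = 0 by rewrite dotC (dot_direction dz eh1).
have xp0 : segment g i *m p != 0 by apply: contra_neq x0; exact: flat_chart_ind pa dx.
rewrite xp yp; apply: (@signed_angle_bend _ _ _ _ _ _ _ _ k (d 0 (enter g i))) => //.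
- exact: frame_normal_unit F1.
- exact: frame_normal_unit F2.
- exact: frame_normal_conormal F1.
- by rewrite dotC (dot_direction dz eh2).
- by rewrite dotC (dot_direction dz hN1).
- have := dot_unitv xp0; rewrite xp !dotE e11 ze1 (dotC (c *m p)) ze1; lra.
rewrite dotC (frame_apex F2 wh hN1) dotC; congr (_ * _).
have lN : dot N1 (pos p (leave g i) - pos p w) = 0.
  by case: NU1 => _; apply; [exact: finset.setU11|exact: finset.setU1r].
by move: lN; rewrite !(dotDl, dotDr, dotNl, dotNr) !(dotC _ N1); lra.
Qed.

End PathCrossing.

Lemma leave_neq_enter (R : realType) (V : nat) (S : {set {set 'I_V}})
    (g : polygonal_path R V) i :
  is_path S g -> (i < ncross g)%N -> leave g i != enter g i.
Proof.
by move=> [_ step _ _ _] /step[lf + _]; apply: contraNneq => <-.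
Qed.

Lemma coherent_normals (R : realType) (V n : nat) (S : {set {set 'I_V}})
    (p : 'M[R]_(V, n.+1)) (normal : {set 'I_V} -> 'rV[R]_n.+1) l
    (h : {set 'I_V}) a b (c d : 'rV[R]_V) :
  (0 < n)%N -> positive_normals S p normal ->
  a \notin h -> b \notin h -> a != b -> #|h| = n -> a |: h \in S -> b |: h \in S ->
  hinge_frame l p h a c (normal (a |: h)) ->
  hinge_frame l p h b d (normal (b |: h)) ->
  c 0 a < 0 -> 0 < d 0 b ->
  dot (normal (a |: h)) (normal (b |: h)) = dot (c *m p) (d *m p).
Proof.
case: n p normal => // n p normal _ [_ Norient] ah bh ab hn aS bS F1 F2 ca db.
pose w i := enum_val (cast_ord (esym hn) i).
have winj : injective w by move=> i j /enum_val_inj /cast_ord_inj.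
have wh i : w i \in h by exact: enum_valP.
apply: (orientation_frames ah bh hn F1 F2 ca db winj wh).
exact: (Norient h a b w).
Qed.

Lemma development_charts (R : realType) (V n : nat) l (T : {set {set 'I_V}}) side e
    (h : {set 'I_V}) a b (C : hinge_chart R V n.+1) :
  side_development l T side e h a b C ->
  flat_chart l (a |: h) (place C) /\ flat_chart l (b |: h) (place C).
Proof.
move=> [r [v [[r0 va vr _] [[Fj _ _ _] _]]]]; split.
  apply: flat_chart_sub (Fj 0%N r0).2; rewrite va; apply: finset.setUS.
  exact: finset.subsetUr.
apply: (flat_chart_sub _ (Fj r.-1 _).2); rewrite prednK// vr.
exact: finset.subsetUr.
Qed.

(** * The geodesic-tangent curvature integral *)

Theorem theorem1 (R : realType) (n : nat) (n_gt0 : (0 < n)%N) :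
  (* Euclidean ambient manifold *)
  (exists C delta : R, 0 < delta /\
    forall (V : nat) (M : set 'rV[R]_n.+1) (S : {set {set 'I_V}})
      (p : 'M[R]_(V, n.+1)) (normal : {set 'I_V} -> 'rV[R]_n.+1)
      (g : polygonal_path R V) (u : nat -> 'M[R]_(V, n)) (nu : nat -> 'rV[R]_n),
    euclidean_approximation M S p ->
    positive_normals S p normal ->
    is_path S g ->
    path_unfolding (edge_length p) g u nu ->
    intrinsically_straight g u ->
    let phi := hinge_angle g (euclidean_chart g p normal) in
    let K := \sum_(i < ncross g)
               tangent_angle g (euclidean_chart g p normal) i in
    (forall i, (i < ncross g)%N -> `|phi i| <= delta) ->
    `|K - \sum_(i < ncross g) cos (theta g u nu i) * phi i|
      <= C * \sum_(i < ncross g) `|phi i| ^+ 3)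
  /\
  (* general ambient manifold: angles are averaged over the two sides of S *)
  (exists C delta : R, 0 < delta /\
    forall (V m : nat) (M N : set 'rV[R]_m) (q : 'M[R]_(V, m))
      (S T : {set {set 'I_V}}) (l : 'I_V -> 'I_V -> R)
      (side : bool -> {set 'I_V} -> {set 'I_V})
      (g : polygonal_path R V) (u : nat -> 'M[R]_(V, n)) (nu : nat -> 'rV[R]_n)
      (D : bool -> nat -> hinge_chart R V n.+1),
    riemannian_approximation (n := n) M N q S T l ->
    two_sided S T side ->
    is_path S g ->
    path_unfolding l g u nu ->
    intrinsically_straight g u ->
    path_developments l T side g D ->
    let phi_side e := hinge_angle g (D e) in
    let phi := mean_angle phi_side in
    let K := \sum_(i < ncross g)
               mean_angle (fun e => tangent_angle g (D e)) i in
    (forall e i, (i < ncross g)%N -> `|phi_side e i| <= delta) ->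
    `|K - \sum_(i < ncross g) cos (theta g u nu i) * phi i|
      <= C * \sum_(i < ncross g)
               `|phi i| * Num.max `|phi_side true i| `|phi_side false i| ^+ 2).
Proof.
split; exists 1, 1; (split; first exact: ltr01).
- move=> V M S p normal g u nu [_ [[pure _] _ flat] _ _] [Nunit Norient].
  move=> gS gu straight phi K phi1.
  rewrite mul1r /K -sumrB (le_trans (ler_norm_sum _ _ _))// ler_sum// => -[i ig] _ /=.
  have [k01 _] := cos_theta n_gt0 pure gS gu ig.
  have [lh eh lf ef] := hinge_sub_facets gS ig.
  have facetS j : (j <= ncross g)%N -> facet g j \in S by move=> jg; case: gS => /(_ _ jg)[].
  have f1S := facetS _ (ltnW ig); have f2S := facetS _ ig.
  have pflat s : s \in S -> flat_chart (edge_length p) s p.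
    by move=> /flat[q]; exact: flat_chart_isometry.
  rewrite (tangent_angle_bend n_gt0 pure gS gu straight ig) ?bend_bound//= ?phi1//;
    [exact: pflat|exact: pflat|exact: Nunit|exact: Nunit|].
  rewrite -lf -ef in f1S f2S *; move=> c d.
  exact: coherent_normals (leave_neq_enter gS ig) (card_hinge pure gS ig) f1S f2S.
- move=> V m M N q S T l side g u nu D [_ [[[[pure _] _ _] _ _] _]] _.
  move=> gS gu straight dev phi_side phi K phi1.
  rewrite mul1r /K -sumrB (le_trans (ler_norm_sum _ _ _))// ler_sum// => -[i ig] _ /=.
  have [k01 _] := cos_theta n_gt0 pure gS gu ig.
  have [lh eh lf ef] := hinge_sub_facets gS ig.
  have bendE e : tangent_angle g (D e) i = bend (cos (theta g u nu i)) (phi_side e i).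
    have de := dev e i ig; have [pa pb] := development_charts de.
    have [r [v [_ [_ [NU1 NU2 _ _]]]]] := de.
    apply: (tangent_angle_bend n_gt0 pure gS gu straight ig); rewrite -?lf -?ef//.
    - move=> c d F1 F2 ca db.
      exact: (coherent_development n_gt0 lh eh (card_hinge pure gS ig) F1 F2 ca db de).
    - exact: phi1.
  by rewrite /mean_angle !bendE bend_mean_bound// phi1.
Qed.
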